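(* For a finite set $\mathcal I$ of experiments, let (P1) with experiment set $\mathcal I$ be the problem of minimizing $\sum_{i\in\mathcal I}\sum_{j\in\mathcal J_i}\lVert x_{ij}-\hat x_i\rVert$ over all variables subject to $$\hat c+A_i^{\top}\lambda_i=0,\quad A_i\hat x_i+s_i=b_i,\quad \lambda_i\le Mz_i,\quad s_i\le M(e-z_i),\quad e^{\top}z_i\ge n\qquad\forall i\in\mathcal I,$$ $$\hat c=\hat c^+-\hat c^-,\quad \hat c^+\le w,\quad \hat c^-\le e-w,\quad e^{\top}(\hat c^++\hat c^-)=1,$$ $$\hat x_i\in\mathbb R^n,\ s_i\in\mathbb R^m_+,\ \lambda_i\in\mathbb R^m_+,\ z_i\in\{0,1\}^m\ \ \forall i\in\mathcal I,\qquad \hat c\in\mathbb R^n,\ \hat c^+,\hat c^-\in\mathbb R^n_+,\ w\in\{0,1\}^n.$$ Let $\mathrm{(P1)}_{\ell}$ and $\mathrm{(P1)}_{[\ell]}$ denote (P1) with $\mathcal I=\{\ell\}$ and $\mathcal I=\{1,\dots,\ell\}$, respectively. Let $\ell\ge 2$ and let $M$ be sufficiently large (i.e. $M\ge M_0$ for some $M_0$ depending only on the data). Let $(\hat x_1,\dots,\hat x_{\ell-1})$ and $\hat x_\ell$ be (the $\hat x$-components of) optimal solutions to $\mathrm{(P1)}_{[\ell-1]}$ and $\mathrm{(P1)}_{\ell}$, respectively. Then $(\hat x_1,\dots,\hat x_\ell)$ is (the $\hat x$-component of) an optimal solution to $\mathrm{(P1)}_{[\ell]}$ if the following problem $(\mathrm{FP})_\ell$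 is feasible: find $\hat c\in\mathbb R^n$, $\hat c^+,\hat c^-\in\mathbb R^n_+$, $w\in\{0,1\}^n$ and $\gamma_{it}\ge 0$ ($i\in\{1,\dots,\ell\}$, $t\in\mathcal T(\hat x_i)$) such that $$\hat c=\sum_{t\in\mathcal T(\hat x_i)}\gamma_{it}(-a_{it})\ \ \forall i\in\{1,\dots,\ell\},\quad \hat c=\hat c^+-\hat c^-,\quad \hat c^+\le w,\quad \hat c^-\le e-w,\quad e^{\top}(\hat c^++\hat c^-)=1.$$
   Context: $n\ge 1$. Experiment $i$ has inputs $A_i\in\mathbb R^{m\times n}$, $b_i\in\mathbb R^m$ such that the polyhedron $\{\tilde x\in\mathbb R^n: A_i\tilde x\le b_i\}$ is compact and nonempty. For each $i$, $\mathcal J_i$ is a finite set of noisy observations with observed points $x_{ij}\in\mathbb R^n$. $\lVert\cdot\rVert$ is a fixed norm on $\mathbb R^n$, $e$ is the all-ones vector of appropriate dimension, and vector inequalities are componentwise. $a_{it}\in\mathbb R^n$ is the $t$-th row of $A_i$ (as a column vector), and $\mathcal T(\hat x_i)=\{t: a_{it}^{\top}\hat x_i=b_{it}\}$ is the set of constraints of experiment $i$ active at $\hat x_i$. The same constant $M$ is used in all instances of (P1). *)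

(* Defs.v *)
From HB Require Import structures.
From mathcomp Require Import all_boot all_order all_algebra.
From mathcomp Require Import all_classical all_reals all_analysis.

Set Implicit Arguments.
Unset Strict Implicit.
Unset Printing Implicit Defensive.

Import Order.TTheory GRing.Theory Num.Theory.
Import numFieldNormedType.Exports.
Local Open Scope ring_scope.

(* An arbitrary norm on R^n; the canonical norm that the library puts on
   matrices is specifically the max norm. *)
Definition is_norm (R : realType) (n : nat) (N : 'cV[R]_n -> R) : Prop :=
  [/\ forall x, 0 <= N x,
      forall x, N x = 0 -> x = 0,
      forall (a : R) x, N (a *: x) = `|a| * N x
    & forall x y, N (x + y) <= N x + N y].

Definition vle (R : realType) (k : nat) (u v : 'cV[R]_k) : Prop :=
  forall t, u t 0 <= v t 0.

Definition ones (R : realType) (k : nat) : 'cV[R]_k := const_mx 1.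

Definition dot (R : realType) (k : nat) (u v : 'cV[R]_k) : R := (u^T *m v) 0 0.

Definition binary (R : realType) (k : nat) (z : 'cV[R]_k) : Prop :=
  forall t, z t 0 = 0 \/ z t 0 = 1.

Record experiment (R : realType) (m n : nat) := Experiment {
  cmat : 'M[R]_(m, n);
  crhs : 'cV[R]_m;
  obs_index : finType;
  obs : obs_index -> 'cV[R]_n }.

Definition polyhedron (R : realType) (m n : nat) (E : experiment R m n) :
    set 'cV[R]_n :=
  [set x | vle (cmat E *m x) (crhs E)]%classic.

Definition cnormal (R : realType) (m n : nat) (E : experiment R m n)
    (t : 'I_m) : 'cV[R]_n :=
  (row t (cmat E))^T.

Definition active (R : realType) (m n : nat) (E : experiment R m n)
    (x : 'cV[R]_n) : {set 'I_m} :=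
  [set t | dot (cnormal E t) x == crhs E t 0].

(* The constraints on (c, c+, c-, w) that (P1) and (FP) have in common. *)
Definition cost_constraints (R : realType) (n : nat)
    (c cpos cneg w : 'cV[R]_n) : Prop :=
  [/\ [/\ vle 0 cpos, vle 0 cneg & binary w],
      c = cpos - cneg,
      vle cpos w,
      vle cneg (ones R n - w)
    & dot (ones R n) (cpos + cneg) = 1].

(* The variables of (P1).  The experiments are indexed by the finite type K,
   and (P1) is posed for a subset I of K: the components of xhat, slack, lam
   and z at indices outside I are unconstrained and play no role. *)
Record P1_point (R : realType) (m n : nat) (K : finType) := P1Point {
  xhat : K -> 'cV[R]_n;
  slack : K -> 'cV[R]_m;
  lam : K -> 'cV[R]_m;
  zvar : K -> 'cV[R]_m;
  chat : 'cV[R]_n;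
  cpos : 'cV[R]_n;
  cneg : 'cV[R]_n;
  wvar : 'cV[R]_n }.

Definition P1_feasible (R : realType) (m n : nat) (K : finType)
    (E : K -> experiment R m n) (M : R) (I : {set K})
    (v : P1_point R m n K) : Prop :=
  (forall i, i \in I ->
    [/\ [/\ vle 0 (slack v i), vle 0 (lam v i) & binary (zvar v i)],
        chat v + (cmat (E i))^T *m lam v i = 0,
        cmat (E i) *m xhat v i + slack v i = crhs (E i),
        vle (lam v i) (M *: zvar v i)
          /\ vle (slack v i) (M *: (ones R m - zvar v i))
      & n%:R <= dot (ones R m) (zvar v i)])
  /\ cost_constraints (chat v) (cpos v) (cneg v) (wvar v).

Definition P1_objective (R : realType) (m n : nat) (K : finType)
    (N : 'cV[R]_n -> R) (E : K -> experiment R m n) (I : {set K})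
    (v : P1_point R m n K) : R :=
  \sum_(i in I) \sum_(j : obs_index (E i)) N (obs j - xhat v i).

Definition P1_optimal (R : realType) (m n : nat) (K : finType)
    (N : 'cV[R]_n -> R) (E : K -> experiment R m n) (M : R) (I : {set K})
    (v : P1_point R m n K) : Prop :=
  P1_feasible E M I v /\
  forall v', P1_feasible E M I v' ->
    P1_objective N E I v <= P1_objective N E I v'.

(* The family (x i), i in I, is the xhat-component of an optimal solution of
   (P1) with experiment set I; the values of x outside I are irrelevant. *)
Definition P1_optimal_xhat (R : realType) (m n : nat) (K : finType)
    (N : 'cV[R]_n -> R) (E : K -> experiment R m n) (M : R) (I : {set K})
    (x : K -> 'cV[R]_n) : Prop :=
  exists v : P1_point R m n K,
    P1_optimal N E M I v /\ forall i, i \in I -> xhat v i = x i.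

(* gamma i t is only meaningful for t in the active set at x i. *)
Definition FP_feasible (R : realType) (m n : nat) (K : finType)
    (E : K -> experiment R m n) (x : K -> 'cV[R]_n) : Prop :=
  exists (c cpos cneg w : 'cV[R]_n) (gamma : K -> 'I_m -> R),
    [/\ forall i t, t \in active (E i) (x i) -> 0 <= gamma i t,
        forall i, c = \sum_(t in active (E i) (x i))
                        gamma i t *: (- cnormal (E i) t)
      & cost_constraints c cpos cneg w].

(* Main.v *)
Require Import Defs.
From HB Require Import structures.
From mathcomp Require Import all_boot all_order all_algebra.
From mathcomp Require Import all_classical all_reals all_analysis.

Set Implicit Arguments.
Unset Strict Implicit.
Unset Printing Implicit Defensive.

Import Order.TTheory GRing.Theory Num.Theory.
Import numFieldNormedType.Exports.
Local Open Scope ring_scope.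

(** The objective of (P1) is a sum over the experiments, and a point that is
    feasible for the experiments of two sets together is feasible for each set
    separately.  Hence optimal solutions for two disjoint sets, if they can be
    glued into one feasible point for the union, are optimal for the union
    ([P1_optimal_xhatU]).  The glued xhat needs a common cost vector, and (FP)
    supplies one.

    What remains is to see that this cost vector fits the constraints in which
    [M] and [n] occur ([FP_P1_feasible]).  Let z_i be the indicator of the
    constraints active at xhat_i.  In the given optimal solutions z_it = 1
    forces s_it = 0, so the given z_i is below this indicator, which therefore
    has at least n ones; and the given slacks are already at most [M], for the
    same [M].  Only the multipliers gamma_i of (FP) may exceed [M].  By
    Caratheodory's theorem they can be replaced by nonnegative multipliers of
    the same vector that sit on linearly independent rows of A_i; these are the
    image of the cost vector under one of finitely many linear maps, one for
    each set of rows, and the cost vector has entries in [-1, 1].  This bounds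
    them by a constant depending on A_i only ([bounded_multipliers]). *)

(** * Conic combinations of rows with bounded coefficients *)

Section ConicCombinations.
Variables (R : realFieldType) (m n : nat) (A : 'M[R]_(m, n)).
Implicit Types (g u : 'rV[R]_m) (S : {set 'I_m}).

Definition supp u : {set 'I_m} := [set t | u 0 t != 0].

Lemma supp_out u S t : supp u \subset S -> t \notin S -> u 0 t = 0.
Proof.
move=> /fintype.subsetP uS tS; apply/eqP; apply: contraNT tS => ut.
by apply: uS; rewrite inE.
Qed.

(** Moving from [g] in the direction [- u] keeps the combination of rows; the
    ratio test of the simplex method gives the longest step that keeps the
    coefficients nonnegative, and that step makes one of them vanish. *)
Lemma shrink_supp g u :
  (forall t, 0 <= g 0 t) -> supp u \subset supp g -> u *m A = 0 -> u != 0 ->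
  exists g', [/\ forall t, 0 <= g' 0 t, supp g' \proper supp g
    & g' *m A = g *m A].
Proof.
move=> g0.
wlog [t0 ut0] : u / exists t, 0 < u 0 t.
  move=> H su uA un0.
  have [t ut] : exists t, u 0 t != 0.
    apply/existsP; apply: contraNT un0 => /existsPn u0.
    by apply/eqP/rowP => t; rewrite mxE; apply/eqP; have := u0 t; rewrite negbK.
  case: (ltP 0 (u 0 t)) => [ut0|ut0]; first by apply: (H u) => //; exists t.
  apply: (H (- u)); rewrite ?oppr_eq0 ?mulNmx ?uA ?oppr0 //.
    by exists t; rewrite mxE oppr_gt0 lt_neqAle ut.
  by apply: fintype.subset_trans su; apply/fintype.subsetP => s; rewrite !inE mxE oppr_eq0.
move=> su uA _.
case: (@arg_minP _ _ _ t0 (fun t => 0 < u 0 t) (fun t => g 0 t / u 0 t) ut0).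
move=> t ut tmin.
exists (g - (g 0 t / u 0 t) *: u); split.
- move=> s; rewrite !mxE subr_ge0; case: (ltP 0 (u 0 s)) => us.
    by rewrite -ler_pdivlMr // tmin.
  by apply: le_trans (g0 s); rewrite mulr_ge0_le0 // divr_ge0 // ltW.
- apply/fintype.properP; split.
    apply/fintype.subsetP => s; apply: contraTT => sg.
    rewrite inE !mxE (supp_out su sg) (supp_out (subxx _) sg).
    by rewrite mulr0 subr0 eqxx.
  exists t; first by apply: (fintype.subsetP su); rewrite inE gt_eqF.
  by rewrite inE !mxE divfK ?subrr ?eqxx // gt_eqF.
- by rewrite mulmxBl -scalemxAl uA scaler0 subr0.
Qed.

(** Caratheodory's theorem for cones: a representation of minimal support uses
    linearly independent rows. *)
Lemma caratheodory g : (forall t, 0 <= g 0 t) ->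
  exists g', [/\ forall t, 0 <= g' 0 t, supp g' \subset supp g,
    g' *m A = g *m A
    & forall u, supp u \subset supp g' -> u *m A = 0 -> u = 0].
Proof.
have [k] := ubnP #|supp g|; elim: k g => // k IH g gk g0.
have [free|] := pselect (forall u, supp u \subset supp g -> u *m A = 0 -> u = 0).
  by exists g.
move=> /existsNP[u /not_implyP[su /not_implyP[uA /eqP un0]]].
have [g1 [g10 sg1 g1A]] := shrink_supp g0 su uA un0.
have [|g2 [g20 sg2 g2A free]] := IH g1 _ g10.
  exact: leq_trans (fintype.proper_card sg1) gk.
exists g2; split=> //; last by rewrite g2A.
exact: fintype.subset_trans sg2 (fintype.proper_sub sg1).
Qed.

(** The rows of [A] with index in [S], the other rows being set to zero rather
    than removed, so that the coefficients keep their indices. *)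
Definition rows_in S : 'M[R]_(m, n) := \matrix_(t, k) (A t k *+ (t \in S)).

Lemma mul_rows_in u S :
  u *m rows_in S = (\row_t (u 0 t *+ (t \in S))) *m A.
Proof.
apply/rowP => k; rewrite !mxE; apply: eq_bigr => t _; rewrite !mxE.
by case: (t \in S); rewrite ?mulr0n ?mulr1n ?mulr0 ?mul0r.
Qed.

Definition multiplier_bound : R :=
  \sum_S \sum_t \sum_k `|pinvmx (rows_in S) k t|.

Lemma multiplier_bound_ge0 : 0 <= multiplier_bound.
Proof. by do 3!apply: sumr_ge0 => ? _. Qed.

Lemma multiplier_bound_ge S t :
  \sum_k `|pinvmx (rows_in S) k t| <= multiplier_bound.
Proof.
rewrite /multiplier_bound (bigD1 S) //= (bigD1 t) //= -addrA lerDl.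
by apply: addr_ge0; do !apply: sumr_ge0 => ? _.
Qed.

(** On a linearly independent set of rows the coefficients are determined by
    the combination, so they can be computed with a partial inverse that
    depends on the set of rows only. *)
Lemma bounded_multipliers g :
  (forall t, 0 <= g 0 t) -> (forall k, `|(g *m A) 0 k| <= 1) ->
  exists g', [/\ forall t, 0 <= g' 0 t, supp g' \subset supp g,
    g' *m A = g *m A & forall t, g' 0 t <= multiplier_bound].
Proof.
move=> /caratheodory[h [h0 sh hA free]] g1; exists h; split=> // t.
set S := supp h in free.
pose p := h *m A *m pinvmx (rows_in S).
pose q : 'rV[R]_m := \row_s (p 0 s *+ (s \in S)).
have hS : h *m rows_in S = h *m A.
  rewrite mul_rows_in; congr (_ *m A); apply/rowP => s; rewrite mxE.
  have [_|sS] := boolP (s \in S); first by rewrite mulr1n.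
  by rewrite (supp_out (subxx _) sS).
have qA : q *m A = h *m A.
  by rewrite -mul_rows_in mulmxKpV // -hS submxMl.
have hq : h = q.
  apply/eqP; rewrite -subr_eq0; apply/eqP/free; last first.
    by rewrite mulmxBl qA subrr.
  apply/fintype.subsetP => s; apply: contraTT => sS.
  by rewrite inE !mxE (negPf sS) (supp_out (subxx _) sS) subr0 eqxx.
have [tS|tS] := boolP (t \in S); last first.
  by rewrite (supp_out (subxx _) tS) multiplier_bound_ge0.
apply: le_trans (multiplier_bound_ge S t).
rewrite hq mxE tS mulr1n mxE; apply: le_trans (ler_norm _) _.
apply: le_trans (ler_norm_sum _ _ _) _; apply: ler_sum => k _.
by rewrite normrM hA ler_piMl.
Qed.

End ConicCombinations.

(** * Gluing solutions of (P1) *)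

Section Gluing.
Variables (R : realType) (m n : nat) (K : finType).
Variables (N : 'cV[R]_n -> R) (E : K -> experiment R m n) (M : R).
Implicit Types (v : P1_point R m n K) (x : K -> 'cV[R]_n) (I J : {set K}).

Lemma P1_feasibleS I J v :
  I \subset J -> P1_feasible E M J v -> P1_feasible E M I v.
Proof. by move=> /fintype.subsetP IJ [vJ vc]; split=> // i /IJ; apply: vJ. Qed.

Lemma eq_P1_objective I v v' : (forall i, i \in I -> xhat v i = xhat v' i) ->
  P1_objective N E I v = P1_objective N E I v'.
Proof.
by move=> vv'; apply: eq_bigr => i iI; apply: eq_bigr => j _; rewrite vv'.
Qed.

Lemma P1_objectiveU I J v : [disjoint I & J] ->
  P1_objective N E (I :|: J) v = P1_objective N E I v + P1_objective N E J v.
Proof. by move=> dIJ; rewrite /P1_objective (eq_bigl [predU I & J]) ?bigU // => i; rewrite !inE. Qed.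

Lemma P1_optimal_xhatU I J x : [disjoint I & J] ->
  P1_optimal_xhat N E M I x -> P1_optimal_xhat N E M J x ->
  (exists v, P1_feasible E M (I :|: J) v /\
    forall i, i \in I :|: J -> xhat v i = x i) ->
  P1_optimal_xhat N E M (I :|: J) x.
Proof.
move=> dIJ [vI [[_ optI] xI]] [vJ [[_ optJ] xJ]] [v [fv xv]].
exists v; split=> //; split=> // v' fv'.
rewrite !P1_objectiveU //; apply: lerD.
- rewrite (@eq_P1_objective I v vI); last first.
    by move=> i iI; rewrite xI // xv // inE iI.
  exact/optI/P1_feasibleS/fv'/finset.subsetUl.
- rewrite (@eq_P1_objective J v vJ); last first.
    by move=> i iJ; rewrite xJ // xv // inE iJ orbT.
  exact/optJ/P1_feasibleS/fv'/finset.subsetUr.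
Qed.

Lemma dot_cnormal (e : experiment R m n) (x : 'cV[R]_n) t :
  dot (cnormal e t) x = (cmat e *m x) t 0.
Proof. by rewrite /dot /cnormal trmxK -row_mul mxE. Qed.

Lemma cost_le1 (c cp cn w : 'cV[R]_n) :
  cost_constraints c cp cn w -> forall k, `|c k 0| <= 1.
Proof.
move=> [[cp0 cn0 bw] -> cpw cnw _] k.
move: (cp0 k) (cn0 k) (cpw k) (cnw k); rewrite !mxE ler_norml => p0 n0 pw nw.
have [w0 w1] : 0 <= w k 0 /\ w k 0 <= 1 by case: (bw k) => ->; rewrite !lexx ler01.
apply/andP; split.
  rewrite -[leLHS]add0r; apply: lerB => //; apply: le_trans nw _.
  by rewrite gerBl.
by apply: (le_trans (y := cp k 0)); rewrite ?gerBl // (le_trans pw).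
Qed.

(** For large [M], the constraints [lam <= M z] and [s <= M (e - z)] let [z] be
    any set between the support of [lam] and the active set; the largest choice
    is the best for the constraint that [z] has at least [n] ones. *)
Definition active_indicator (e : experiment R m n) (x : 'cV[R]_n) : 'cV[R]_m :=
  \col_t (t \in active e x)%:R.

(** The hypothesis that each [x i] comes from some feasible point with the same
    [M] gives the bound on the slacks and the [n] active constraints, neither of
    which follows from (FP). *)
Lemma FP_P1_feasible x :
  (forall i, multiplier_bound (cmat (E i)) <= M) -> 0 <= M ->
  (forall i, exists I v, [/\ i \in I, P1_feasible E M I v & xhat v i = x i]) ->
  FP_feasible E x ->
  exists v, P1_feasible E M [set: K] v /\ xhat v = x.
Proof.
move=> leM M0 P1x [c [cp [cn [w [gam [gam0 cE cc]]]]]].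
have /fin_all_exists[g gP] i : exists g : 'rV[R]_m,
    [/\ forall t, 0 <= g 0 t, supp g \subset active (E i) (x i),
     g *m cmat (E i) = - c^T & forall t, g 0 t <= M].
  pose h : 'rV[R]_m := \row_t (if t \in active (E i) (x i) then gam i t else 0).
  have hA : h *m cmat (E i) = - c^T.
    apply/rowP => k; rewrite (cE i) !mxE summxE -sumrN [RHS]big_mkcond.
    apply: eq_bigr => t _ /=; rewrite !mxE.
    by case: ifP; rewrite ?mul0r // mulrN opprK.
  have h0 t : 0 <= h 0 t by rewrite mxE; case: ifP => // /gam0.
  have h1 k : `|(h *m cmat (E i)) 0 k| <= 1.
    by rewrite hA !mxE normrN (cost_le1 cc).
  have [g [g0 sg gA gb]] := bounded_multipliers h0 h1.
  exists g; split=> // [||t].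
  - apply: fintype.subset_trans sg _; apply/fintype.subsetP => t; rewrite inE mxE.
    by case: ifP; rewrite ?eqxx.
  - by rewrite gA.
  - exact: le_trans (gb t) (leM i).
exists (P1Point x (fun i => crhs (E i) - cmat (E i) *m x i)
  (fun i => (g i)^T) (fun i => active_indicator (E i) (x i)) c cp cn w).
split=> //; split=> //= i _.
have [g0 sg gA gM] := gP i.
have [I [v [iI [fv _] vx]]] := P1x i.
case: (fv i iI) => [[s0 _ bz] _ sE [_ sM] nz].
have {}sE : crhs (E i) - cmat (E i) *m x i = slack v i.
  by rewrite -sE vx addrC addKr.
have actE t : (t \in active (E i) (x i)) = (slack v i t 0 == 0).
  by rewrite inE dot_cnormal -sE !mxE subr_eq0 eq_sym.
rewrite sE; split.
- split=> // t; rewrite !mxE //.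
  by case: (t \in _); [right|left].
- by apply: trmx_inj; rewrite linearD /= trmx_mul !trmxK gA subrr trmx0.
- by rewrite -sE addrC subrK.
- split=> t; move: (sM t); rewrite !mxE.
    have [_|tA] := boolP (t \in _); first by rewrite mulr1.
    by rewrite (supp_out sg tA) mulr0.
  rewrite actE; have [->|_] := eqVneq; first by rewrite subrr mulr0.
  move=> /le_trans; apply; apply: ler_wpM2l => //; rewrite subr0 gerBl.
  by case: (bz t) => ->.
- apply: le_trans nz _; rewrite /dot !mxE; apply: ler_sum => t _.
  rewrite !mxE !mul1r; case: (bz t) => zt; rewrite zt ?ler0n //.
  (* z = 1 leaves no room for a positive slack *)
  have := s0 t; rewrite mxE => st_ge0.
  have := sM t; rewrite !mxE zt subrr mulr0 => st_le0.
  by rewrite actE eq_le st_le0 st_ge0.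
Qed.

End Gluing.

(* Experiment k of {1, ..., l} is the element of 'I_l with value k - 1. *)
Theorem corollary3 (R : realType) (m n l : nat) (n_ge1 : (1 <= n)%N)
    (l_ge2 : (2 <= l)%N)
    (N : 'cV[R]_n -> R) (normN : is_norm N)
    (E : 'I_l -> experiment R m n)
    (cptE : forall i, compact (polyhedron (E i)))
    (neE : forall i, exists x, polyhedron (E i) x) :
  exists M0 : R, forall M : R, M0 <= M ->
    forall x : 'I_l -> 'cV[R]_n,
      P1_optimal_xhat N E M [set i : 'I_l | (i < l.-1)%N] x ->
      P1_optimal_xhat N E M [set i : 'I_l | i == l.-1 :> nat] x ->
      FP_feasible E x ->
      P1_optimal_xhat N E M [set: 'I_l] x.
Proof.
exists (\sum_i multiplier_bound (cmat (E i))) => M leM x optI optJ FPx.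
set I := [set i : 'I_l | _] in optI; set J := [set i : 'I_l | _] in optJ.
have dIJ : [disjoint I & J].
  rewrite -finset.setI_eq0; apply/eqP/finset.setP => i; rewrite !inE.
  by apply/negP => /andP[/ltn_eqF ->].
have IJ : I :|: J = [set: 'I_l].
  apply/finset.setP => i; rewrite !inE orbC -leq_eqVlt -ltnS prednK ?ltn_ord //.
  exact: ltnW.
rewrite -IJ; apply: P1_optimal_xhatU => //; rewrite IJ.
suff [v [fv xv]] : exists v, P1_feasible E M [set: 'I_l] v /\ xhat v = x.
  by exists v; split=> // i _; rewrite xv.
apply: FP_P1_feasible FPx.
- move=> i; apply: le_trans leM; rewrite (bigD1 i) //= lerDl.
  by apply: sumr_ge0 => ? _; exact: multiplier_bound_ge0.
- by apply: le_trans leM; apply: sumr_ge0 => ? _; exact: multiplier_bound_ge0.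
- move=> i; have : i \in I :|: J by rewrite IJ inE.
  rewrite inE => /orP[iI|iJ].
    by have [v [[fv _] xv]] := optI; exists I, v; rewrite xv.
  by have [v [[fv _] xv]] := optJ; exists J, v; rewrite xv.
Qed.
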